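(* The factorization $G^s=G^s_1G^s_2$ holds: every $\Phi\in G^s=\mathrm{Diff}^+(\mathbb{R}^{1,1})$ has a unique decomposition $\Phi=\psi\varphi$ with $\psi\in G^s_1$ and $\varphi\in G^s_2$. Explicitly, if $\Phi(x,\theta)=(A(x)+B(x)\theta,\;C(x)+D(x)\theta)$, then $\psi=\pi_1(\Phi)$ and $\varphi=\pi_2(\Phi)$, where $$\pi_1(\Phi)(x,\theta)=\begin{pmatrix}\dot A(0)&B(0)\\ \dot C(0)&D(0)\end{pmatrix}\begin{pmatrix}x\\ \theta\end{pmatrix}+\begin{pmatrix}A(0)\\ C(0)\end{pmatrix}\in G^s_1,$$ $$\pi_2(\Phi)(x,\theta)=\begin{pmatrix}\dot A(0)&B(0)\\ \dot C(0)&D(0)\end{pmatrix}^{-1}\bigl(\Phi(x,\theta)-\Phi(0,0)\bigr)\in G^s_2 .$$ Here pairs are regarded as column vectors and $\Phi(0,0)=(A(0),C(0))$.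
   Context: Let $x$ be the even and $\theta$ the odd coordinate of the superline $\mathbb{R}^{1,1}$ (so $\theta^2=0$). A dot denotes $d/dx$. The product of transformations is composition (substitution). Coefficients are taken in an auxiliary real Grassmann algebra $\Lambda=\Lambda_0\oplus\Lambda_1$: even (resp. odd) functions of $x$ and even (resp. odd) constants take values in $\Lambda_0$ (resp. $\Lambda_1$); odd elements anticommute with each other and with $\theta$, and even elements commute with everything. Conditions such as ''$>0$'' and ''diffeomorphism'' refer to the body (the image under $\Lambda\to\mathbb{R}$). Functions of $x$ are evaluated at even quantities with nilpotent part by Taylor expansion. The supergroup $G^s=\mathrm{Diff}^+(\mathbb{R}^{1,1})$ of orientation preserving diffeomorphisms of the superline is defined as the set of all $\Phi(x,\theta)=(A(x)+B(x)\theta,\;C(x)+D(x)\theta)$ such that $A(x),D(x)$ are even, $A,D\in\mathrm{Diff}(\mathbb{R})$, $\dot A(x)>0$, $\dot D(x)>0$, and $B(x),C(x)$ are odd. The affine part $G^s_1$ is defined as the set of $\psi(x,\theta)=(ax+b\theta+e,\;cx+d\theta+f)\in G^s$ with $a,e,d$ even, $a,d>0$, and $b,c,f$ odd. For $\Phi=(\Phi_1,\Phi_2)$ with $\Phi_1=A(x)+B(x)\theta$ and $\Phi_2=C(x)+D(x)\theta$, put $$J\Phi(x,\theta)=\begin{pmatrix}\partial\Phi_1/\partial x&-\partial\Phi_1/\partial\theta\\ \partial\Phi_2/\partial x&\partial\Phi_2/\partial\theta\end{pmatrix}=\begin{pmatrix}\dot A(x)+\dot B(x)\theta&B(x)\\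 \dot C(x)+\dot D(x)\theta&D(x)\end{pmatrix},$$ where $\partial/\partial x$ is even and $\partial/\partial\theta$ is odd; thus the matrix appearing in the formulas for $\pi_1,\pi_2$ is $J\Phi(0,0)$. The subgroup $G^s_2$ is defined as the set of $\varphi=(A(x)+B(x)\theta,\;C(x)+D(x)\theta)\in G^s$ with $\varphi(0,0)=0$ and $J\varphi(0,0)=1$, in other words $A(0)=B(0)=C(0)=\dot C(0)=0$ and $\dot A(0)=D(0)=1$. The inverse of a supermatrix with $a,d$ even and $b,c$ odd is $$\begin{pmatrix}a&b\\ c&d\end{pmatrix}^{-1}=\frac{1}{da}\begin{pmatrix}d+\frac{bc}{a}&-b\\ -c&a+\frac{cb}{d}\end{pmatrix}.$$
   Formalization: The condition that D is a diffeomorphism of the line with positive derivative is replaced by D smooth with D(x)>0 (body) for all x; as written, every affine map (D=d constant) would be excluded, G^s_1 would be empty and the factorization false. *)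

(* Defs.v *)
From HB Require Import structures.
From mathcomp Require Import all_boot all_order all_algebra.
From mathcomp Require Import ring boolp reals.

Set Implicit Arguments.
Unset Strict Implicit.
Unset Printing Implicit Defensive.

Import Order.TTheory GRing.Theory Num.Theory.

Local Open Scope ring_scope.

(* The real Grassmann algebra Lambda on n anticommuting generators e_i.  An
   element is the family of its coordinates in the basis e_S, S a set of
   generators, where e_S is the product of the e_i, i in S, in increasing
   order of i. *)
Definition grassmann (R : realType) (n : nat) := {ffun {set 'I_n} -> R^o}.

HB.instance Definition _ (R : realType) (n : nat) :=
  GRing.Lmodule.copy (grassmann R n) {ffun {set 'I_n} -> R^o}.

(* Number of transpositions that sort e_S e_T:
   e_S e_T = (-1)^(ninv S T) e_(S :|: T) for disjoint S and T. *)
Definition ninv (n : nat) (S T : {set 'I_n}) : nat :=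
  (\sum_(i in S) \sum_(j in T) (j < i))%N.

Lemma sum_setU_disjoint (I : finType) (S T : {set I}) (F : I -> nat) :
  [disjoint S & T] ->
  (\sum_(i in S :|: T) F i = \sum_(i in S) F i + \sum_(i in T) F i)%N.
Proof.
by move=> dST; rewrite -bigU //; apply: eq_bigl => i; rewrite !inE.
Qed.

Lemma ninvUl n (S T V : {set 'I_n}) : [disjoint S & T] ->
  ninv (S :|: T) V = (ninv S V + ninv T V)%N.
Proof. by move=> dST; rewrite /ninv sum_setU_disjoint. Qed.

Lemma ninvUr n (S T V : {set 'I_n}) : [disjoint T & V] ->
  ninv S (T :|: V) = (ninv S T + ninv S V)%N.
Proof.
by move=> dTV; rewrite /ninv -big_split; apply: eq_bigr => i _;
  rewrite sum_setU_disjoint.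
Qed.

Section GrassmannRing.
Variables (R : realType) (n : nat).
Implicit Types (a b c : grassmann R n) (S T U V : {set 'I_n}).

Definition gr_one : grassmann R n := [ffun S : {set 'I_n} => ((S == set0)%:R : R)].

Definition gr_mul a b : grassmann R n :=
  [ffun U : {set 'I_n} => \sum_(S : {set 'I_n} | S \subset U)
               (-1) ^+ ninv S (U :\: S) * (a S : R) * (b (U :\: S) : R)].

Lemma grP a b : (forall S, a S = b S) -> a = b.
Proof. by move=> eab; apply/ffunP. Qed.

Lemma gr_mulA : associative gr_mul.
Proof.
move=> a b c; apply: grP => U; rewrite !ffunE.
transitivity (\sum_(S : {set 'I_n} | S \subset U)
  \sum_(V : {set 'I_n} | (S \subset V) && (V \subset U))
   ((-1) ^+ (ninv S (V :\: S) + ninv V (U :\: V)) *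
      ((a S : R) * (b (V :\: S) : R) * (c (U :\: V) : R)))).
  apply: eq_bigr => S sSU; rewrite ffunE mulr_sumr.
  rewrite (reindex_onto (fun V => V :\: S) (fun T => S :|: T)) /=; last first.
    move=> T; rewrite subsetD => /andP[_ dTS].
    by rewrite setDUl setDv set0U; apply/setDidPl.
  apply: eq_big => [V|V].
    apply/idP/idP.
      move=> /andP[sVU /eqP <-]; rewrite subsetUl /= subUset sSU /=.
      by apply: subset_trans sVU _; rewrite subsetDl.
    move=> /andP[sSV sVU]; rewrite setSD //=; apply/eqP.
    by rewrite setDE setUIr setUCr setIT; apply/setUidPr.
  move=> /andP[sVU /eqP eV].
  have sSV : S \subset V by rewrite -eV subsetUl.
  have sSVU i : ((i \in S) ==> (i \in V)) && ((i \in V) ==> (i \in U)).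
    apply/andP; split; apply/implyP; first exact: (fintype.subsetP sSV).
    move=> iV; case iS: (i \in S); first exact: (fintype.subsetP sSU).
    by have /fintype.subsetP/(_ i) := sVU; rewrite !inE iS iV => /(_ isT).
  have -> : (U :\: S) :\: (V :\: S) = U :\: V.
    apply/setP=> i; rewrite !inE; have := sSVU i.
    by case: (i \in S); case: (i \in V); case: (i \in U).
  have eUS : U :\: S = (V :\: S) :|: (U :\: V).
    apply/setP=> i; rewrite !inE; have := sSVU i.
    by case: (i \in S); case: (i \in V); case: (i \in U).
  have dV : [disjoint V :\: S & U :\: V].
    rewrite -setI_eq0; apply/eqP/setP=> i; rewrite !inE.
    by do 3 case: (i \in _).
  have -> : ninv V (U :\: V) = (ninv S (U :\: V) + ninv (V :\: S) (U :\: V))%N.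
    rewrite -{1}eV ninvUl //; rewrite -setI_eq0; apply/eqP/setP=> i.
    by rewrite !inE; do 2 case: (i \in _).
  have -> : ninv S (U :\: S) = (ninv S (V :\: S) + ninv S (U :\: V))%N.
    by rewrite eUS ninvUr.
  by rewrite !exprD; ring.
rewrite (exchange_big_dep (fun V : {set 'I_n} => V \subset U)) /=; last first.
  by move=> S V _ /andP[].
apply: eq_bigr => V sVU; rewrite ffunE mulr_sumr mulr_suml.
apply: eq_big => [S|S _].
  by rewrite sVU andbT andb_idl // => sSV; apply: subset_trans sSV sVU.
by rewrite addnC exprD -!mulrA; congr (_ * _); rewrite !mulrA.
Qed.

Lemma gr_mul1l : left_id gr_one gr_mul.
Proof.
move=> a; apply: grP => U; rewrite ffunE (bigD1 set0) ?sub0set //= big1.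
  by rewrite ffunE eqxx setD0 /ninv big_set0 expr0 !mul1r addr0.
by move=> S /andP[_ /negPf S0]; rewrite ffunE S0 mulr0 mul0r.
Qed.

Lemma gr_mul1r : right_id gr_one gr_mul.
Proof.
move=> a; apply: grP => U; rewrite ffunE (bigD1 U) //= big1.
  rewrite ffunE setDv eqxx /ninv big1 ?expr0 ?mul1r ?mulr1 ?addr0 //.
  by move=> i _; rewrite big_set0.
move=> S /andP[sSU nSU]; rewrite [gr_one _]ffunE.
have /negPf-> : U :\: S != set0; last by rewrite mulr0.
by rewrite setD_eq0; apply: contra nSU => sUS; rewrite finset.eqEsubset sSU.
Qed.

Lemma gr_mulDl : left_distributive gr_mul +%R.
Proof.
move=> a b c; apply: grP => U; rewrite !ffunE -big_split.
by apply: eq_bigr => S _; rewrite ffunE mulrDr mulrDl.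
Qed.

Lemma gr_mulDr : right_distributive gr_mul +%R.
Proof.
move=> a b c; apply: grP => U; rewrite !ffunE -big_split.
by apply: eq_bigr => S _; rewrite ffunE mulrDr.
Qed.

Lemma gr_one_neq0 : gr_one != 0.
Proof.
by apply/eqP=> /ffunP/(_ set0)/eqP; rewrite !ffunE eqxx /= oner_eq0.
Qed.

HB.instance Definition _ := GRing.Zmodule_isNzRing.Build (grassmann R n)
  gr_mulA gr_mul1l gr_mul1r gr_mulDl gr_mulDr gr_one_neq0.

Lemma gr_scaleAl (k : R) a b : k *: (a * b) = (k *: a) * b.
Proof.
apply: grP => U; rewrite !ffunE scaler_sumr; apply: eq_bigr => S _.
by rewrite ffunE /GRing.scale /= !mulrA [k * _]mulrC.
Qed.

HB.instance Definition _ :=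
  GRing.Lmodule_isLalgebra.Build R (grassmann R n) gr_scaleAl.

Lemma gr_scaleAr (k : R) a b : k *: (a * b) = a * (k *: b).
Proof.
apply: grP => U; rewrite !ffunE scaler_sumr; apply: eq_bigr => S _.
by rewrite ffunE /GRing.scale /= mulrCA.
Qed.

HB.instance Definition _ :=
  GRing.Lalgebra_isAlgebra.Build R (grassmann R n) gr_scaleAr.

Definition gr_unit : pred (grassmann R n) :=
  fun a => `[< exists b, b * a = 1 /\ a * b = 1 >].

Definition gr_inv a : grassmann R n :=
  match pselect (exists b, b * a = 1 /\ a * b = 1) with
  | left e => projT1 (cid e)
  | right _ => a
  end.

Lemma gr_mulVr : {in gr_unit, left_inverse 1 gr_inv *%R}.
Proof.
move=> a /asboolP ua; rewrite /gr_inv; case: pselect => // e.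
by case: cid => b [].
Qed.

Lemma gr_mulrV : {in gr_unit, right_inverse 1 gr_inv *%R}.
Proof.
move=> a /asboolP ua; rewrite /gr_inv; case: pselect => // e.
by case: cid => b [].
Qed.

Lemma gr_unitP a b : b * a = 1 /\ a * b = 1 -> gr_unit a.
Proof. by move=> ab; apply/asboolP; exists b. Qed.

Lemma gr_inv_out : {in [predC gr_unit], gr_inv =1 id}.
Proof.
by move=> a /asboolPn nu; rewrite /gr_inv; case: pselect.
Qed.

HB.instance Definition _ := GRing.NzRing_hasMulInverse.Build (grassmann R n)
  gr_mulVr gr_mulrV gr_unitP gr_inv_out.

Definition body a : R := a set0.

Definition even_elt a : Prop := forall S, odd #|S| -> a S = 0.
Definition odd_elt a : Prop := forall S, ~~ odd #|S| -> a S = 0.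

(* the parity automorphism, so that theta * a = grade a * theta *)
Definition grade a : grassmann R n := [ffun S : {set 'I_n} => (-1) ^+ #|S| * (a S : R)].

Lemma grade_is_zmod_morphism : zmod_morphism grade.
Proof. by move=> a b; apply: grP => S; rewrite !ffunE mulrBr. Qed.

HB.instance Definition _ := GRing.isZmodMorphism.Build
  (grassmann R n) (grassmann R n) grade grade_is_zmod_morphism.

Lemma grade_is_monoid_morphism : monoid_morphism grade.
Proof.
split=> [|a b].
  apply: grP => S; rewrite !ffunE; case: eqVneq => [->|]; last by rewrite mulr0.
  by rewrite cards0 mul1r.
apply: grP => U; rewrite !ffunE mulr_sumr; apply: eq_bigr => S sSU.
rewrite !ffunE -(cardsID S U) (setIidPr sSU) exprD.
set x := (-1) ^+ #|S|; set y := (-1) ^+ #|_|; set z := (-1) ^+ _.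
rewrite -!mulrA [RHS]mulrCA; congr (_ * _).
by rewrite mulrCA; congr (_ * _); rewrite mulrCA.
Qed.

HB.instance Definition _ := GRing.isMonoidMorphism.Build
  (grassmann R n) (grassmann R n) grade grade_is_monoid_morphism.

End GrassmannRing.

(* Lambda[theta]: the pair (a, b) stands for a + b theta. *)
Definition grtheta (R : realType) (n : nat) :=
  (grassmann R n * grassmann R n)%type.

HB.instance Definition _ (R : realType) (n : nat) :=
  GRing.Zmodule.copy (grtheta R n) (grassmann R n * grassmann R n)%type.

Section ThetaRing.
Variables (R : realType) (n : nat).
Implicit Types (u v w : grtheta R n).

Definition gt_one : grtheta R n := (1, 0).

(* (a + b theta) (c + d theta) = a c + (a d + b (grade c)) theta *)
Definition gt_mul u v : grtheta R n :=
  (u.1 * v.1, u.1 * v.2 + u.2 * grade v.1).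

Lemma gt_mulA : associative gt_mul.
Proof.
move=> u v w; congr pair; rewrite /= ?mulrA //.
by rewrite rmorphM mulrDr mulrDl !mulrA addrA.
Qed.

Lemma gt_mul1l : left_id gt_one gt_mul.
Proof. by case=> a b; rewrite /gt_mul /= !mul1r mul0r addr0. Qed.

Lemma gt_mul1r : right_id gt_one gt_mul.
Proof. by case=> a b; rewrite /gt_mul /= rmorph1 !mulr1 mulr0 add0r. Qed.

Lemma gt_mulDl : left_distributive gt_mul +%R.
Proof.
by move=> u v w; congr pair; rewrite /= !mulrDl // addrACA.
Qed.

Lemma gt_mulDr : right_distributive gt_mul +%R.
Proof.
by move=> u v w; congr pair; rewrite /= ?raddfD /= !mulrDr // addrACA.
Qed.

Lemma gt_one_neq0 : gt_one != 0.
Proof. by apply/eqP => -[/eqP]; rewrite oner_eq0. Qed.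

HB.instance Definition _ := GRing.Zmodule_isNzRing.Build (grtheta R n)
  gt_mulA gt_mul1l gt_mul1r gt_mulDl gt_mulDr gt_one_neq0.

Definition theta : grtheta R n := (0, 1).

Definition iota (a : grassmann R n) : grtheta R n := (a, 0).

Definition tbody u : R := body u.1.

Definition tsoul u : grtheta R n := u - iota (tbody u)%:A.

End ThetaRing.

(* Imported only here because classical_sets shadows the finset lemma names and
   notations used above. *)
From mathcomp Require Import all_classical all_reals all_analysis.
Import numFieldNormedType.Exports.
Local Open Scope classical_set_scope.

Section SuperLine.
Variables (R : realType) (n : nat).

Local Notation Lambda := (grassmann R n).
Local Notation LambdaT := (grtheta R n).

Definition smooth (f : R -> R) : Prop := forall k x, derivable (f^`(k)) x 1.

Definition Diff (f : R -> R) : Prop :=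
  smooth f /\ exists g : R -> R, [/\ smooth g, cancel f g & cancel g f].

(* Lambda is finite dimensional, so smoothness and derivatives of Lambda-valued
   functions of x are coordinatewise. *)
Definition gsmooth (f : R -> Lambda) : Prop :=
  forall S : {set 'I_n}, smooth (fun x => f x S).

Definition gderiv (k : nat) (f : R -> Lambda) (x : R) : Lambda :=
  [ffun S : {set 'I_n} => ((fun y => f y S : R)^`(k)) x].

(* The value of f at an even u, by Taylor expansion at the body of u.  The sum
   is the full Taylor series since tsoul u ^+ n.+2 = 0: Lambda[theta] has n.+1
   odd generators. *)
Definition taylor (f : R -> Lambda) (u : LambdaT) : LambdaT :=
  \sum_(k < n.+2) iota ((k`!%:R : R)^-1 *: gderiv k f (tbody u)) * tsoul u ^+ k.

Definition col2 (T : Type) (u v : T) : 'cV[T]_2 :=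
  \col_(i < 2) if i == 0 then u else v.

Definition mx2 (T : Type) (a b c d : T) : 'M[T]_2 :=
  \matrix_(i < 2, j < 2)
    if i == 0 then (if j == 0 then a else b) else (if j == 0 then c else d).

(* Phi x is the column vector Phi(x, theta), with entries in Lambda[theta]. *)
Definition supermap := R -> 'cV[LambdaT]_2.

Implicit Types (Phi Psi : supermap).

(* Phi(x, theta) = (A x + B x theta, C x + D x theta) *)
Definition coefA Phi (x : R) : Lambda := (Phi x 0 0).1.
Definition coefB Phi (x : R) : Lambda := (Phi x 0 0).2.
Definition coefC Phi (x : R) : Lambda := (Phi x 1 0).1.
Definition coefD Phi (x : R) : Lambda := (Phi x 1 0).2.

(* Psi Phi: substitution of Phi(x, theta) for (x, theta) in Psi *)
Definition supercomp Psi Phi : supermap := fun x =>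
  let u := Phi x 0 0 in let t := Phi x 1 0 in
  col2 (taylor (coefA Psi) u + taylor (coefB Psi) u * t)
       (taylor (coefC Psi) u + taylor (coefD Psi) u * t).

(* Orientation preservation in the odd direction is the condition D x > 0 on
   the coefficient of theta.  It is not required that D, as a function of x, be
   an increasing diffeomorphism of the line: that would exclude every affine
   map, in particular the identity, for which D = 1. *)
Record Gs Phi : Prop := {
  Gs_smoothA : gsmooth (coefA Phi);
  Gs_smoothB : gsmooth (coefB Phi);
  Gs_smoothC : gsmooth (coefC Phi);
  Gs_smoothD : gsmooth (coefD Phi);
  Gs_evenA : forall x, even_elt (coefA Phi x);
  Gs_oddB : forall x, odd_elt (coefB Phi x);
  Gs_oddC : forall x, odd_elt (coefC Phi x);
  Gs_evenD : forall x, even_elt (coefD Phi x);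
  Gs_diffA : Diff (fun x => body (coefA Phi x));
  Gs_derivA : forall x, 0 < body (gderiv 1 (coefA Phi) x);
  Gs_posD : forall x, 0 < body (coefD Phi x)
}.

Definition Gs1 (psi : supermap) : Prop :=
  Gs psi /\
  exists a b c d e f : Lambda,
    [/\ even_elt a, even_elt d, even_elt e, 0 < body a & 0 < body d] /\
    [/\ odd_elt b, odd_elt c & odd_elt f] /\
    forall x : R,
      psi x = col2 (iota a * iota x%:A + iota b * theta R n + iota e)
                   (iota c * iota x%:A + iota d * theta R n + iota f).

Definition partial_x (w : R -> LambdaT) (x : R) : LambdaT :=
  (gderiv 1 (fun y => (w y).1) x, gderiv 1 (fun y => (w y).2) x).

(* The left derivative: partial_theta (b theta) = grade b, because the odd
   derivation partial_theta has to be moved across b. *)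
Definition partial_theta (w : R -> LambdaT) (x : R) : LambdaT :=
  iota (grade (w x).2).

Definition superjac Phi (x : R) : 'M[LambdaT]_2 :=
  let Phi1 := fun y => Phi y 0 0 in let Phi2 := fun y => Phi y 1 0 in
  mx2 (partial_x Phi1 x) (- partial_theta Phi1 x)
      (partial_x Phi2 x) (partial_theta Phi2 x).

(* Setting theta = 0 takes the first component. *)
Definition at_theta0 (p q : nat) (M : 'M[LambdaT]_(p, q)) : 'M[Lambda]_(p, q) :=
  map_mx fst M.

Definition Gs2 (phi : supermap) : Prop :=
  [/\ Gs phi, at_theta0 (phi 0) = 0 & at_theta0 (superjac phi 0) = 1%:M].

(* Inverse of a supermatrix with even invertible diagonal entries a, d and odd
   off-diagonal entries b, c *)
Definition superinv (M : 'M[Lambda]_2) : 'M[Lambda]_2 :=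
  let a := M 0 0 in let b := M 0 1 in let c := M 1 0 in let d := M 1 1 in
  (d * a)^-1 *: mx2 (d + b * c / a) (- b) (- c) (a + c * b / d).

Definition jac0 Phi : 'M[Lambda]_2 :=
  mx2 (gderiv 1 (coefA Phi) 0) (coefB Phi 0)
      (gderiv 1 (coefC Phi) 0) (coefD Phi 0).

Definition val0 Phi : 'cV[Lambda]_2 := col2 (coefA Phi 0) (coefC Phi 0).

Definition pi1 Phi : supermap := fun x =>
  map_mx (@iota R n) (jac0 Phi) *m col2 (iota x%:A) (theta R n)
  + map_mx (@iota R n) (val0 Phi).

Definition pi2 Phi : supermap := fun x =>
  map_mx (@iota R n) (superinv (jac0 Phi))
    *m (Phi x - map_mx (@iota R n) (val0 Phi)).

End SuperLine.

(* Main.v *)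
From HB Require Import structures.
From mathcomp Require Import all_boot all_order all_algebra reals.
Require Import Defs.

(** The affine map psi(x, theta) = M (x, theta)^T + v acts on a supermap phi
   by psi phi = M phi + v, because the Taylor expansion of an affine function
   stops after the linear term.  Taking the value and the Jacobian at the origin
   gives (psi phi)(0) = M phi(0) + v and J(psi phi)(0) = M Jphi(0); for phi in
   G_2 these are v and M.  Hence psi is determined by Phi = psi phi, and
   phi = M^-1 (Phi - v) with the supermatrix inverse, which exists since an
   element of Lambda with nonzero body is invertible. *)

Set Implicit Arguments.
Unset Strict Implicit.
Unset Printing Implicit Defensive.

Import Order.TTheory GRing.Theory Num.Theory.
Local Open Scope ring_scope.

(** * Entries of matrices of size two *)

Lemma ord2P (P : 'I_2 -> Prop) : P 0 -> P 1 -> forall i, P i.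
Proof.
by move=> P0 P1 [[|[|//]] i2]; [move: P0 | move: P1]; congr P; exact/val_inj.
Qed.

Lemma mulmx2E (K : pzRingType) m (M : 'M[K]_2) (N : 'M[K]_(2, m)) i j :
  (M *m N) i j = M i 0 * N 0 j + M i 1 * N 1 j.
Proof.
rewrite mxE !big_ord_recl big_ord0 addr0.
by have -> : lift ord0 ord0 = 1 :> 'I_2 by exact/val_inj.
Qed.

(** * Signs and parity in the Grassmann algebra *)

Section Grassmann.
Variables (R : realType) (n : nat).
Implicit Types (a b c : grassmann R n) (S T U : {set 'I_n}).

Lemma grME a b U : (a * b) U = \sum_(S : {set 'I_n} | S \subset U)
  (-1) ^+ ninv S (U :\: S) * (a S : R) * (b (U :\: S) : R).
Proof. exact: ffunE. Qed.

(** Each pair in S x T has distinct entries by disjointness, so exactly one of the two numbers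
    counts it. *)
Lemma ninv_swap S T : [disjoint S & T] ->
  (ninv S T + ninv T S = #|S| * #|T|)%N.
Proof.
move=> dST; rewrite /ninv [X in (_ + X)%N]exchange_big -big_split /=.
rewrite -sum_nat_const; apply: eq_bigr => i iS; rewrite -big_split /=.
rewrite -sum1_card; apply: eq_bigr => j jT.
case: (ltngtP (i : nat) j) => // /ord_inj ij.
by move/pred0P/(_ i): dST => /=; rewrite iS ij jT.
Qed.

(** Reindexing by the complement in U writes b a over the same terms as a b, with the sign given by
    [ninv_swap]. The commutation rules can then be checked term by term. *)
Lemma grM_swapE a b U : (b * a) U = \sum_(S : {set 'I_n} | S \subset U)
  (-1) ^+ (#|S| * #|U :\: S|) *
    ((-1) ^+ ninv S (U :\: S) * (a S : R) * (b (U :\: S) : R)).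
Proof.
rewrite grME (reindex_onto (fun S => U :\: S) (fun S => U :\: S)) /=;
  last first.
  by move=> S sSU; rewrite setDDr setDv set0U; apply/setIidPr.
apply: eq_big => [S|S /andP[_ /eqP eS]].
  rewrite subsetDl setDDr setDv set0U; apply/eqP/idP => [<-|/setIidPr //].
  exact: subsetIl.
rewrite eS -ninv_swap; last first.
  by apply/pred0P => i /=; rewrite !inE; case: (i \in S); rewrite ?andbF.
rewrite exprD -!mulrA; set x := (-1) ^+ ninv S _; set y := (-1) ^+ ninv _ S.
rewrite [y * (x * _)]mulrCA [x * (x * _)]mulrA -expr2 sqrr_sign mul1r.
by rewrite [(b _ : R) * _]mulrC.
Qed.

(** Parity becomes an eigenvector condition for the ring morphism [grade], so closure under sums,
    products and inverses reduces to rewriting. The converse holds because 2 is invertible in the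
    reals. *)
Lemma even_grade a : even_elt a <-> grade a = a.
Proof.
split=> [ea | ga S oS].
  apply: grP => S; rewrite ffunE -signr_odd.
  by case: (boolP (odd _)) => [/ea ->|]; rewrite ?mulr0 // mul1r.
have /(congr1 (fun c : grassmann R n => c S : R)) := ga.
rewrite ffunE -signr_odd oS expr1 mulN1r => /eqP.
by rewrite eq_sym -addr_eq0 -mulr2n mulrn_eq0 => /eqP.
Qed.

Lemma odd_grade a : odd_elt a <-> grade a = - a.
Proof.
split=> [oa | ga S eS].
  apply: grP => S; rewrite !ffunE -signr_odd.
  case: (boolP (odd _)) => [_|/oa ->]; last by rewrite mulr0 oppr0.
  by rewrite expr1 mulN1r.
have /(congr1 (fun c : grassmann R n => c S : R)) := ga.
rewrite !ffunE -signr_odd (negPf eS) expr0 mul1r => /eqP.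
by rewrite -addr_eq0 -mulr2n mulrn_eq0 => /eqP.
Qed.

(** Where the coordinate of a can be nonzero, |S| is even, and so is the exponent |S| |U \ S| of the
    exchange sign. *)
Lemma even_eltC a b : even_elt a -> a * b = b * a.
Proof.
move=> ea; apply: grP => U; rewrite [RHS]grM_swapE grME; apply: eq_bigr => S _.
case: (boolP (odd #|S|)) => [/ea ->|eS]; first by rewrite mulr0 mul0r mulr0.
by rewrite -[(-1) ^+ (_ * _)%N]signr_odd oddM (negPf eS) mul1r.
Qed.

Lemma odd_eltC a b : odd_elt a -> odd_elt b -> a * b = - (b * a).
Proof.
move=> oa ob; apply: grP => U; rewrite grME ffunE [in RHS]grM_swapE -sumrN.
apply: eq_bigr => S _.
case: (boolP (odd #|S|)) => [oS|/oa ->];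
  last by rewrite mulr0 mul0r mulr0 oppr0.
case: (boolP (odd #|U :\: S|)) => [oUS|/ob ->]; last by rewrite !mulr0 oppr0.
by rewrite -[(-1) ^+ (_ * _)%N]signr_odd oddM oS oUS mulN1r opprK.
Qed.

Lemma odd_elt_sqr a : odd_elt a -> a * a = 0.
Proof.
move=> oa; apply: grP => S; have := odd_eltC oa oa.
move/(congr1 (fun c : grassmann R n => c S : R)); rewrite !ffunE => /eqP.
by rewrite -addr_eq0 -mulr2n mulrn_eq0 => /eqP.
Qed.

Lemma even_elt1 : even_elt (1 : grassmann R n).
Proof. by apply/even_grade; rewrite rmorph1. Qed.

Lemma odd_elt0 : odd_elt (0 : grassmann R n).
Proof. by apply/odd_grade; rewrite rmorph0 oppr0. Qed.

Lemma even_eltD a b : even_elt a -> even_elt b -> even_elt (a + b).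
Proof.
by move=> /even_grade ga /even_grade gb;
  apply/even_grade; rewrite rmorphD /= ga gb.
Qed.

Lemma odd_eltD a b : odd_elt a -> odd_elt b -> odd_elt (a + b).
Proof.
by move=> /odd_grade ga /odd_grade gb;
  apply/odd_grade; rewrite rmorphD /= ga gb opprD.
Qed.

Lemma even_eltN a : even_elt a -> even_elt (- a).
Proof. by move=> /even_grade ga; apply/even_grade; rewrite rmorphN /= ga. Qed.

Lemma odd_eltN a : odd_elt a -> odd_elt (- a).
Proof. by move=> /odd_grade ga; apply/odd_grade; rewrite rmorphN /= ga. Qed.

Lemma even_even_eltM a b : even_elt a -> even_elt b -> even_elt (a * b).
Proof.
by move=> /even_grade ga /even_grade gb;
  apply/even_grade; rewrite rmorphM /= ga gb.
Qed.

Lemma odd_odd_eltM a b : odd_elt a -> odd_elt b -> even_elt (a * b).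
Proof.
by move=> /odd_grade ga /odd_grade gb;
  apply/even_grade; rewrite rmorphM /= ga gb mulrNN.
Qed.

Lemma even_odd_eltM a b : even_elt a -> odd_elt b -> odd_elt (a * b).
Proof.
by move=> /even_grade ga /odd_grade gb;
  apply/odd_grade; rewrite rmorphM /= ga gb mulrN.
Qed.

Lemma odd_even_eltM a b : odd_elt a -> even_elt b -> odd_elt (a * b).
Proof.
by move=> /odd_grade ga /even_grade gb;
  apply/odd_grade; rewrite rmorphM /= ga gb mulNr.
Qed.

Lemma even_eltV a : a \is a GRing.unit -> even_elt a -> even_elt a^-1.
Proof.
by move=> ua /even_grade ga; apply/even_grade; rewrite rmorphV //= ga.
Qed.

(** * The body morphism, nilpotence of the soul, and units *)

Lemma body_is_zmod_morphism : zmod_morphism (@body R n).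
Proof. by move=> a b; rewrite /body !ffunE. Qed.

HB.instance Definition _ := GRing.isZmodMorphism.Build
  (grassmann R n) R (@body R n) body_is_zmod_morphism.

Lemma body_is_monoid_morphism : monoid_morphism (@body R n).
Proof.
split=> [|a b]; first by rewrite /body ffunE eqxx.
rewrite /body grME (big_pred1 set0) => [|S]; last exact: subset0.
by rewrite setD0 /ninv big_set0 mul1r.
Qed.

HB.instance Definition _ := GRing.isMonoidMorphism.Build
  (grassmann R n) R (@body R n) body_is_monoid_morphism.

Lemma body_scale (k : R) a : body (k *: a) = k * body a.
Proof. by rewrite /body ffunE. Qed.

Lemma body_odd a : odd_elt a -> body a = 0.
Proof. by apply; rewrite cards0. Qed.

(* The filtration by the degree in the generators makes the soul nilpotent. *)
Lemma expr_low_degree a k : body a = 0 ->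
  forall S, (#|S| < k)%N -> (a ^+ k) S = 0.
Proof.
move=> ba; elim: k => [//|k IHk] S; rewrite ltnS => kS.
rewrite exprS grME big1 // => T sTS.
have [->|T0] := eqVneq T set0; first by rewrite [a _]ba mulr0 mul0r.
rewrite IHk ?mulr0 // cardsD (setIidPr sTS); apply: leq_trans kS.
by rewrite ltn_subrL card_gt0 T0;
  apply: leq_trans (subset_leq_card sTS); rewrite card_gt0.
Qed.

(** A set of generators has at most n elements, so no coordinate survives in degree n + 1. *)
Lemma soul_nilpotent a : body a = 0 -> a ^+ n.+1 = 0.
Proof.
move=> ba; apply: grP => S; rewrite ffunE expr_low_degree // ltnS.
by rewrite -[X in (_ <= X)%N]card_ord max_card.
Qed.

(** Write a = body(a) (1 - s) with s nilpotent; the geometric series in s is finite and inverts 1 -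
    s. Both sides are checked, since the ring is not commutative. *)
Lemma grassmann_unit a : body a != 0 -> a \is a GRing.unit.
Proof.
move=> ba; pose s := 1 - (body a)^-1 *: a.
have bs : body s = 0.
  by rewrite rmorphB rmorph1 /= body_scale mulVf ?subrr.
have es : a = body a *: (1 - s).
  by rewrite opprB addrC subrK scalerA mulfV ?scale1r.
pose t := (body a)^-1 *: \sum_(i < n.+1) s ^+ i.
have e1 : (1 - s) * (\sum_(i < n.+1) s ^+ i) = 1.
  by rewrite -[1 - s]opprB mulNr -subrX1 soul_nilpotent // sub0r opprK.
have e2 : (\sum_(i < n.+1) s ^+ i) * (1 - s) = 1.
  rewrite -{2}e1 mulr_suml mulr_sumr; apply: eq_bigr => i _.
  by rewrite mulrBr mulrBl mulr1 mul1r -exprSr exprS.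
apply/unitrP; exists t; rewrite es /t; split.
  by rewrite -!scalerAl -scalerAr e2 scalerA mulVf ?scale1r.
by rewrite -!scalerAl -scalerAr e1 scalerA mulfV ?scale1r.
Qed.

(** * Invertible supermatrices with positive diagonal bodies *)

Definition super_gl2 (M : 'M[grassmann R n]_2) : Prop :=
  [/\ even_elt (M 0 0), even_elt (M 1 1), odd_elt (M 0 1) & odd_elt (M 1 0)] /\
  (0 < body (M 0 0) /\ 0 < body (M 1 1)).

(** Even entries are central, and the cubic terms b c b and c b c vanish because odd elements
    anticommute and square to zero. What remains of either product is d a times the identity. *)
Lemma superinvK M : super_gl2 M ->
  superinv M *m M = 1%:M /\ M *m superinv M = 1%:M.
Proof.
rewrite /superinv.
set a := M 0 0; set b := M 0 1; set c := M 1 0; set d := M 1 1.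
move=> [[ea ed ob oc] [a0 d0]].
have ua : a \is a GRing.unit by rewrite grassmann_unit ?gt_eqF.
have ud : d \is a GRing.unit by rewrite grassmann_unit ?gt_eqF.
have uda : d * a \is a GRing.unit.
  by rewrite unitrM_comm ?ud ?ua //; exact: even_eltC.
have eda : even_elt (d * a)^-1 by apply: even_eltV => //; exact: even_even_eltM.
have eV x : a^-1 * x = x * a^-1 by exact/even_eltC/even_eltV.
have dV x : d^-1 * x = x * d^-1 by exact/even_eltC/even_eltV.
have aC x : a * x = x * a by exact: even_eltC.
have dC x : d * x = x * d by exact: even_eltC.
have bcb : b * c * b = 0.
  by rewrite (odd_eltC ob oc) mulNr -mulrA odd_elt_sqr // mulr0 oppr0.
have cbc : c * b * c = 0.
  by rewrite (odd_eltC oc ob) mulNr -mulrA odd_elt_sqr // mulr0 oppr0.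
pose Y := mx2 (d + b * c / a) (- b) (- c) (a + c * b / d).
have YM : Y *m M = (d * a)%:M.
  apply/matrixP => i j; rewrite mulmx2E !mxE.
  move: i j; apply: ord2P; apply: ord2P;
    rewrite /= -?/a -?/b -?/c -?/d ?mulr1n ?mulr0n !mulrDl.
  - by rewrite mulrVK // mulNr addrK.
  - by rewrite -[_ / _ * _]mulrA eV mulrA bcb mul0r addr0 mulNr dC subrr.
  - by rewrite -[_ / _ * _]mulrA dV mulrA cbc mul0r addr0 mulNr aC addNr.
  - by rewrite mulrVK // mulNr addrC addrK aC.
have MY : M *m Y = (d * a)%:M.
  apply/matrixP => i j; rewrite mulmx2E !mxE.
  move: i j; apply: ord2P; apply: ord2P;
    rewrite /= -?/a -?/b -?/c -?/d ?mulr1n ?mulr0n !mulrDr.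
  - by rewrite [a * (_ / _)]aC mulrVK // mulrN addrK aC.
  - by rewrite !mulrA bcb mul0r addr0 mulrN aC addNr.
  - by rewrite !mulrA cbc mul0r addr0 mulrN dC subrr.
  - by rewrite [d * (_ / _)]dC mulrVK // mulrN addrC addrK.
rewrite -/Y; split.
  by rewrite -scalemxAl YM scale_scalar_mx mulVr.
(* Over a noncommutative ring a left scalar does not pass through M in general; this one does, being
   even and hence central. *)
transitivity ((d * a)^-1 *: (M *m Y)); last by rewrite MY scale_scalar_mx mulVr.
apply/matrixP => i j; rewrite !mxE mulr_sumr; apply: eq_bigr => k _.
by rewrite !mxE [LHS]mulrA -(even_eltC _ eda) mulrA.
Qed.

(** The corrections b c / a and c b / d are even with zero body, so they affect neither the parity
    nor the positivity of the diagonal. *)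
Lemma super_gl2_inv M : super_gl2 M -> super_gl2 (superinv M).
Proof.
rewrite /super_gl2 /superinv !mxE /=.
set a := M 0 0; set b := M 0 1; set c := M 1 0; set d := M 1 1.
move=> [[ea ed ob oc] [a0 d0]].
have ua : a \is a GRing.unit by rewrite grassmann_unit ?gt_eqF.
have ud : d \is a GRing.unit by rewrite grassmann_unit ?gt_eqF.
have uda : d * a \is a GRing.unit.
  by rewrite unitrM_comm ?ud ?ua //; exact: even_eltC.
have eda : even_elt (d * a)^-1 by apply: even_eltV => //; exact: even_even_eltM.
have bda : 0 < body (d * a)^-1 by rewrite rmorphV //= invr_gt0 rmorphM mulr_gt0.
have eX : even_elt (d + b * c / a).
  by apply: even_eltD => //; apply: even_even_eltM;
    [exact: odd_odd_eltM | exact: even_eltV].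
have eY : even_elt (a + c * b / d).
  by apply: even_eltD => //; apply: even_even_eltM;
    [exact: odd_odd_eltM | exact: even_eltV].
split; split.
- exact: even_even_eltM.
- exact: even_even_eltM.
- by apply: even_odd_eltM => //; exact: odd_eltN.
- by apply: even_odd_eltM => //; exact: odd_eltN.
- by rewrite rmorphM mulr_gt0 // rmorphD !rmorphM /= (body_odd ob) !mul0r addr0.
- by rewrite rmorphM mulr_gt0 // rmorphD !rmorphM /= (body_odd oc) !mul0r addr0.
Qed.

End Grassmann.

From mathcomp Require Import all_classical all_reals all_analysis.
Import numFieldNormedType.Exports.
Local Open Scope classical_set_scope.
Local Open Scope ring_scope.

(** * Smooth real functions and their successive derivatives *)

Section DerivativeTower.
Variable R : realType.
Implicit Types (f g : R -> R) (d e : nat -> R -> R).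

(** Carrying all derivatives explicitly yields smoothness and the values of the iterated derivatives
    at once, without differentiability side conditions at each order. *)
Definition derivatives f d : Prop :=
  d 0%N = f /\ forall k (x : R), is_derive x 1 (d k) (d k.+1 x).

Lemma derivatives_derive1n f d k : derivatives f d -> derive1n k f = d k.
Proof.
move=> [d0 dS]; elim: k => [|k IHk]; first by rewrite derive1n0 d0.
by rewrite derive1nS IHk; apply/funext => x; rewrite derive1E derive_val.
Qed.

Lemma derivatives_smooth f d : derivatives f d -> smooth f.
Proof.
by move=> fd k x; rewrite (derivatives_derive1n k fd);
  have [_ /(_ k x)[]] := fd.
Qed.

Lemma smooth_derivatives f : smooth f -> derivatives f (fun k => derive1n k f).
Proof.
move=> sf; split=> // k x; rewrite derive1nS derive1E.
exact/derivableP/sf.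
Qed.

Lemma derivativesD f g d e : derivatives f d -> derivatives g e ->
  derivatives (fun x => f x + g x) (fun k x => d k x + e k x).
Proof. by move=> [<- dS] [<- eS]; split=> // k x; exact: is_deriveD. Qed.

Lemma derivativesZ (c : R) f d : derivatives f d ->
  derivatives (fun x => c * f x) (fun k x => c * d k x).
Proof. by move=> [<- dS]; split=> // k x; exact: is_deriveZ. Qed.

Lemma derivatives_cst (c : R) :
  derivatives (fun=> c) (fun k _ => if k is 0 then c else 0).
Proof. by split=> // -[|k] x; exact: is_derive_cst. Qed.

Lemma derivatives_id :
  derivatives id (fun k x => if k is k'.+1 then (k' == 0)%:R else x).
Proof.
by split=> // -[|k] x; [exact: is_derive_id|exact: is_derive_cst].
Qed.

Lemma derivatives_sum (I : finType) (P : pred I) (F : I -> R -> R)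
    (D : I -> nat -> R -> R) : (forall i, derivatives (F i) (D i)) ->
  derivatives (fun x => \sum_(i | P i) F i x)
              (fun k x => \sum_(i | P i) D i k x).
Proof.
(* Unfolding both sums to folds over the list of indices lets one induction treat the function and
   its tower together. *)
move=> FD; rewrite unlock /=; elim: index_enum => [|i s IHs] /=.
  by split=> // k x; exact: is_derive_cst.
by case: (P i) => //; exact: derivativesD.
Qed.

Lemma derivatives_comp_affine (p q : R) f d : derivatives f d ->
  derivatives (fun x => f (p * x + q)) (fun k x => p ^+ k * d k (p * x + q)).
Proof.
move=> [<- dS]; split=> [|k x]; first by apply/funext => x; rewrite mul1r.
have dpq : is_derive x 1 (fun y : R => p * y + q) p.
  have := is_deriveD (is_deriveZ p (is_derive_id x 1)) (is_derive_cst q x 1).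
  by move/is_derive_eq; apply; rewrite addr0; exact: mulr1.
have := is_deriveZ (p ^+ k)
  (@is_derive1_comp _ (d k) (fun y => p * y + q) x _ _ (dS k (p * x + q)) dpq).
move/is_derive_eq; apply; rewrite /GRing.scale /= exprSr -mulrA.
by congr (_ * _); rewrite mulrC.
Qed.

Lemma Diff_affine (a e : R) f : 0 < a -> Diff f -> Diff (fun x => a * f x + e).
Proof.
move=> a0 [sf [g [sg fK gK]]]; split.
  apply: derivatives_smooth; apply: derivativesD; last exact: derivatives_cst.
  exact/derivativesZ/smooth_derivatives.
(* The inverse is g((y - e) / a), put in the form p y + q that [derivatives_comp_affine] expects. *)
exists (fun y => g (a^-1 * y + - (a^-1 * e))); split=> [|x|y].
- exact/derivatives_smooth/derivatives_comp_affine/smooth_derivatives.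
- by rewrite -mulrBr addrK mulKf ?gt_eqF.
- by rewrite gK -mulrBr mulVKf ?gt_eqF // subrK.
Qed.

End DerivativeTower.

(** * Derivatives and Taylor expansion of Grassmann-valued functions *)

Section GrassmannDerivatives.
Variables (R : realType) (n : nat).
Implicit Types (f g : R -> grassmann R n) (d e : nat -> R -> grassmann R n).

Definition gderivatives f d : Prop :=
  forall S, derivatives (fun x => f x S : R) (fun k x => d k x S : R).

Lemma gderivatives_gderiv f d k x : gderivatives f d -> gderiv k f x = d k x.
Proof.
by move=> fd; apply: grP => S; rewrite ffunE (derivatives_derive1n k (fd S)).
Qed.

Lemma gderivatives_gsmooth f d : gderivatives f d -> gsmooth f.
Proof. by move=> fd S; exact: derivatives_smooth (fd S). Qed.

Lemma gsmooth_gderivatives f : gsmooth f ->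
  gderivatives f (fun k => gderiv k f).
Proof.
move=> sf S; have := smooth_derivatives (sf S).
by congr derivatives; apply/funext => k; apply/funext => x; rewrite ffunE.
Qed.

Lemma gderivativesD f g d e : gderivatives f d -> gderivatives g e ->
  gderivatives (fun x => f x + g x) (fun k x => d k x + e k x).
Proof.
move=> fd ge S; have := derivativesD (fd S) (ge S).
congr derivatives; first by apply/funext => x; rewrite ffunE.
by apply/funext => k; apply/funext => x; rewrite ffunE.
Qed.

(** For constant a, each coordinate of a f is a finite real linear combination of coordinates of f,
    so linearity suffices. *)
Lemma gderivativesM (a : grassmann R n) f d : gderivatives f d ->
  gderivatives (fun x => a * f x) (fun k x => a * d k x).
Proof.
move=> fd U.
have := @derivatives_sum R _ (fun S : {set 'I_n} => S \subset U) _ _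
  (fun S => derivativesZ ((-1) ^+ ninv S (U :\: S) * (a S : R)) (fd (U :\: S))).
congr derivatives; first by apply/funext => x; rewrite grME.
by apply/funext => k; apply/funext => x; rewrite grME.
Qed.

Lemma gderivatives_cst (a : grassmann R n) :
  gderivatives (fun=> a) (fun k _ => if k is 0 then a else 0).
Proof.
move=> S; have := derivatives_cst (a S : R); congr derivatives.
by apply/funext => -[|k]; apply/funext => x //; rewrite ffunE.
Qed.

Lemma gderivatives_scalar : gderivatives (fun x => x%:A)
  (fun k x => if k is k'.+1 then (k' == 0)%:R else x%:A).
Proof.
move=> S; have := derivativesZ ((S == finset.set0)%:R : R) (derivatives_id R).
congr derivatives; first by apply/funext => x; rewrite !ffunE mulrC.
apply/funext => -[|[|k]]; apply/funext => x /=; rewrite !ffunE ?mulr1 ?mulr0 //.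
by rewrite mulrC.
Qed.

(** Differentiation is coordinatewise, and a coordinate that vanishes identically has zero
    derivatives. *)
Lemma gderiv_even f k x : (forall y, even_elt (f y)) -> even_elt (gderiv k f x).
Proof.
move=> ef S oS; rewrite ffunE.
have -> : (fun y => f y S : R) = fun=> 0 by apply/funext => y; exact: ef.
by rewrite (derivatives_derive1n k (derivatives_cst _)); case: k.
Qed.

Lemma gderiv_odd f k x : (forall y, odd_elt (f y)) -> odd_elt (gderiv k f x).
Proof.
move=> ef S oS; rewrite ffunE.
have -> : (fun y => f y S : R) = fun=> 0 by apply/funext => y; exact: ef.
by rewrite (derivatives_derive1n k (derivatives_cst _)); case: k.
Qed.

Lemma iota_is_zmod_morphism : zmod_morphism (@iota R n).
Proof. by move=> a b; congr pair; rewrite /= subr0. Qed.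

HB.instance Definition _ := GRing.isZmodMorphism.Build
  (grassmann R n) (grtheta R n) (@iota R n) iota_is_zmod_morphism.

Lemma iota_is_monoid_morphism : monoid_morphism (@iota R n).
Proof. by split=> // a b; congr pair; rewrite /= mulr0 mul0r addr0. Qed.

HB.instance Definition _ := GRing.isMonoidMorphism.Build
  (grassmann R n) (grtheta R n) (@iota R n) iota_is_monoid_morphism.

Lemma taylor_affine (a e : grassmann R n) u :
  taylor (fun x => a * x%:A + e) u = iota a * u + iota e.
Proof.
have fd := gderivativesD (gderivativesM a gderivatives_scalar)
  (gderivatives_cst e).
(* The sum has n + 2 terms, so orders 0 and 1 are present even for n = 0; all later terms vanish.
   The two that remain recombine the body and the soul of u. *)
rewrite /taylor !big_ord_recl /= big1 => [|k _]; last first.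
  by rewrite (gderivatives_gderiv _ _ fd) /= mulr0 addr0 scaler0 rmorph0 mul0r.
rewrite !(gderivatives_gderiv _ _ fd) /= !addr0 fact0 factS mul1n invr1.
by rewrite !scale1r expr0 expr1 !mulr1 rmorphD rmorphM /= /tsoul mulrBr
  addrC addrA subrK.
Qed.

Lemma taylor_cst (a : grassmann R n) u : taylor (fun=> a) u = iota a.
Proof.
have -> : (fun=> a) = fun x : R => 0 * x%:A + a.
  by apply/funext => x; rewrite mul0r add0r.
by rewrite taylor_affine rmorph0 mul0r add0r.
Qed.

End GrassmannDerivatives.

(** * The affine action on supermaps *)

Section AffineAction.
Variables (R : realType) (n : nat).
Implicit Types (M N : 'M[grassmann R n]_2) (v w : 'cV[grassmann R n]_2).
Implicit Types (Phi psi phi : supermap R n).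

Definition super_vec v : Prop := even_elt (v 0 0) /\ odd_elt (v 1 0).

(** Affine maps, [pi1], [pi2] and left composition with an affine map all take this form, so the
    factorization reduces to matrix algebra. *)
Definition act M v Phi : supermap R n := fun x =>
  map_mx (@iota R n) M *m Phi x + map_mx (@iota R n) v.

Definition superid : supermap R n := fun x => col2 (iota x%:A) (theta R n).

Lemma pi1E Phi : pi1 Phi = act (jac0 Phi) (val0 Phi) superid.
Proof. by []. Qed.

Lemma act_comp M N v w Phi :
  act M v (act N w Phi) = act (M *m N) (M *m w + v) Phi.
Proof.
by apply/funext => x; rewrite /act mulmxDr mulmxA map_mxD !map_mxM addrA.
Qed.

Lemma act1 Phi : act 1%:M 0 Phi = Phi.
Proof. by apply/funext => x; rewrite /act map_mx1 map_mx0 mul1mx addr0. Qed.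

Lemma pi2E Phi : pi2 Phi =
  act (superinv (jac0 Phi)) (- (superinv (jac0 Phi) *m val0 Phi)) Phi.
Proof.
by apply/funext => x; rewrite /act map_mxN map_mxM /pi2 mulmxBr.
Qed.

Lemma coefA_act M v Phi : coefA (act M v Phi) =
  fun x => M 0 0 * coefA Phi x + M 0 1 * coefC Phi x + v 0 0.
Proof. by apply/funext => x; rewrite /coefA /act mxE mulmx2E !mxE. Qed.

Lemma coefC_act M v Phi : coefC (act M v Phi) =
  fun x => M 1 0 * coefA Phi x + M 1 1 * coefC Phi x + v 1 0.
Proof. by apply/funext => x; rewrite /coefC /act mxE mulmx2E !mxE. Qed.

(** Left multiplication by [iota a] involves no [grade], so no sign appears; the translation v has
    no theta part. *)
Lemma coefB_act M v Phi : coefB (act M v Phi) =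
  fun x => M 0 0 * coefB Phi x + M 0 1 * coefD Phi x.
Proof.
by apply/funext => x; rewrite /coefB /act mxE mulmx2E !mxE /= !mul0r !addr0.
Qed.

Lemma coefD_act M v Phi : coefD (act M v Phi) =
  fun x => M 1 0 * coefB Phi x + M 1 1 * coefD Phi x.
Proof.
by apply/funext => x; rewrite /coefD /act mxE mulmx2E !mxE /= !mul0r !addr0.
Qed.

Lemma coefA_superid : coefA superid = fun x => x%:A.
Proof. by apply/funext => x; rewrite /coefA /superid mxE. Qed.

Lemma coefB_superid : coefB superid = fun=> 0.
Proof. by apply/funext => x; rewrite /coefB /superid mxE. Qed.

Lemma coefC_superid : coefC superid = fun=> 0.
Proof. by apply/funext => x; rewrite /coefC /superid mxE. Qed.

Lemma coefD_superid : coefD superid = fun=> 1.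
Proof. by apply/funext => x; rewrite /coefD /superid mxE. Qed.

(** The affine map has A and C affine in x and B and D constant, so [taylor_affine] and [taylor_cst]
    evaluate the substitution exactly. *)
Lemma supercomp_act M v phi : supercomp (act M v superid) phi = act M v phi.
Proof.
rewrite /supercomp coefA_act coefB_act coefC_act coefD_act.
rewrite coefA_superid coefB_superid coefC_superid coefD_superid.
have aff (a b e : grassmann R n) :
    (fun x : R => a * x%:A + b * 0 + e) = fun x => a * x%:A + e.
  by apply/funext => x; rewrite mulr0 addr0.
have cst (a b : grassmann R n) :
    (fun x : R => a * 0 + b * 1) = fun=> b.
  by apply/funext => x; rewrite mulr0 add0r mulr1.
rewrite !aff !cst; apply/funext => x; apply/matrixP => i j.
rewrite !taylor_affine !taylor_cst (ord1 j) /act [RHS]mxE mulmx2E !mxE.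
by move: i; apply: ord2P => /=; rewrite addrAC.
Qed.

Lemma Gs_superid : Gs superid.
Proof.
have body_id : (fun x : R => body (x%:A : grassmann R n)) = id.
  by apply/funext => x; rewrite body_scale rmorph1 mulr1.
split; rewrite ?coefA_superid ?coefB_superid ?coefC_superid ?coefD_superid.
- exact/gderivatives_gsmooth/gderivatives_scalar.
- exact/gderivatives_gsmooth/gderivatives_cst.
- exact/gderivatives_gsmooth/gderivatives_cst.
- exact/gderivatives_gsmooth/gderivatives_cst.
- move=> x; apply/even_grade; apply: grP => S; rewrite !ffunE.
  by case: eqVneq => [->|_]; rewrite ?cards0 ?mul1r // !scaler0 mulr0.
- by move=> x; exact: odd_elt0.
- by move=> x; exact: odd_elt0.
- by move=> x; exact: even_elt1.
- rewrite body_id; split; first exact/derivatives_smooth/derivatives_id.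
  by exists id; split=> //; exact/derivatives_smooth/derivatives_id.
- move=> x; rewrite (gderivatives_gderiv _ _ (@gderivatives_scalar R n)) /=.
  by rewrite rmorph1.
- by move=> x; rewrite rmorph1.
Qed.

Lemma gderivatives_lin (a b e : grassmann R n) f g :
  gsmooth f -> gsmooth g ->
  gderivatives (fun x => a * f x + b * g x + e)
    (fun k x => a * gderiv k f x + b * gderiv k g x +
                (if k is 0 then e else 0)).
Proof.
move=> sf sg; apply: gderivativesD; last exact: gderivatives_cst.
by apply: gderivativesD; exact/gderivativesM/gsmooth_gderivatives.
Qed.

Lemma gsmooth_lin (a b : grassmann R n) f g :
  gsmooth f -> gsmooth g -> gsmooth (fun x => a * f x + b * g x).
Proof.
move=> sf sg; apply: gderivatives_gsmooth.
by apply: gderivativesD; exact/gderivativesM/gsmooth_gderivatives.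
Qed.

(** The off-diagonal entries of M are odd and have zero body. On bodies, A is thus changed by an
    increasing real affine map and D is multiplied by a positive constant. *)
Lemma Gs_act M v Phi : super_gl2 M -> super_vec v -> Gs Phi -> Gs (act M v Phi).
Proof.
move=> [[eM00 eM11 oM01 oM10] [M00 M11]] [ev0 ov1].
case=> sA sB sC sD eA oB oC eD dA pA pD.
split; rewrite ?coefA_act ?coefB_act ?coefC_act ?coefD_act.
- exact: gderivatives_gsmooth (gderivatives_lin _ _ _ sA sC).
- exact: gsmooth_lin.
- exact: gderivatives_gsmooth (gderivatives_lin _ _ _ sA sC).
- exact: gsmooth_lin.
- move=> x; apply: even_eltD => //.
  by apply: even_eltD; [exact: even_even_eltM|exact: odd_odd_eltM].
- by move=> x; apply: odd_eltD; [exact: even_odd_eltM|exact: odd_even_eltM].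
- move=> x; apply: odd_eltD => //.
  by apply: odd_eltD; [exact: odd_even_eltM|exact: even_odd_eltM].
- by move=> x; apply: even_eltD; [exact: odd_odd_eltM|exact: even_even_eltM].
- have := Diff_affine (body (v 0 0)) M00 dA; congr Diff; apply/funext => x.
  by rewrite !rmorphD !rmorphM /= (body_odd oM01) mul0r addr0.
- move=> x; rewrite (gderivatives_gderiv _ _ (gderivatives_lin _ _ _ sA sC)) /=.
  by rewrite addr0 rmorphD !rmorphM /= (body_odd oM01) mul0r addr0 mulr_gt0.
- move=> x; rewrite rmorphD !rmorphM /= (body_odd oM10) mul0r add0r.
  exact: mulr_gt0.
Qed.

Lemma val0_act M v Phi : val0 (act M v Phi) = M *m val0 Phi + v.
Proof.
apply/matrixP => i j; rewrite (ord1 j) [RHS]mxE mulmx2E !mxE.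
by move: i; apply: ord2P; rewrite ?coefA_act ?coefC_act.
Qed.

(** Differentiation in x kills v and commutes with left multiplication by the constant entries of M;
    the theta coefficients do not see v. *)
Lemma jac0_act M v Phi : Gs Phi -> jac0 (act M v Phi) = M *m jac0 Phi.
Proof.
move=> G; have [sA sC] := (Gs_smoothA G, Gs_smoothC G).
have dlin a b e := gderivatives_gderiv 1 0 (gderivatives_lin a b e sA sC).
apply/matrixP => i j; rewrite mulmx2E !mxE.
rewrite coefA_act coefB_act coefC_act coefD_act.
by move: i j; apply: ord2P; apply: ord2P; rewrite /= ?dlin ?addr0.
Qed.

Lemma super_gl2_jac0 Phi : Gs Phi -> super_gl2 (jac0 Phi).
Proof.
move=> G; rewrite /super_gl2 !mxE /=; split; split.
- exact/gderiv_even/(Gs_evenA G).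
- exact: (Gs_evenD G).
- exact: (Gs_oddB G).
- exact/gderiv_odd/(Gs_oddC G).
- exact: (Gs_derivA G).
- exact: (Gs_posD G).
Qed.

Lemma super_vec_val0 Phi : Gs Phi -> super_vec (val0 Phi).
Proof.
move=> G; rewrite /super_vec !mxE /=.
by split; [exact: (Gs_evenA G) | exact: (Gs_oddC G)].
Qed.

Lemma super_vecN v : super_vec v -> super_vec (- v).
Proof.
by move=> [e0 o1]; rewrite /super_vec !mxE; split;
  [exact: even_eltN|exact: odd_eltN].
Qed.

Lemma super_vecM M v : super_gl2 M -> super_vec v -> super_vec (M *m v).
Proof.
move=> [[e00 e11 o01 o10] _] [e0 o1]; rewrite /super_vec !mulmx2E; split.
  by apply: even_eltD; [exact: even_even_eltM|exact: odd_odd_eltM].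
by apply: odd_eltD; [exact: odd_even_eltM|exact: even_odd_eltM].
Qed.

(** The affine part is the orbit of the identity under [act]; the converse gets membership in [Gs]
    from [Gs_act] applied to [superid]. *)
Lemma Gs1P psi : Gs1 psi <->
  exists M v, [/\ super_gl2 M, super_vec v & psi = act M v superid].
Proof.
split.
  move=> [_ [a [b [c [d [e [f [[ea ed ee a0 d0] [[ob oc of_] psiE]]]]]]]]].
  exists (mx2 a b c d), (col2 e f); rewrite /super_gl2 /super_vec !mxE.
  split=> //; apply/funext => x; rewrite psiE; apply/matrixP => i j.
  rewrite (ord1 j) /act [RHS]mxE mulmx2E !mxE.
  by move: i; apply: ord2P.
move=> [M [v [gM gv ->]]]; split; first exact/Gs_act/Gs_superid.
have [[e00 e11 o01 o10] [M00 M11]] := gM; have [e0 o1] := gv.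
exists (M 0 0), (M 0 1), (M 1 0), (M 1 1), (v 0 0), (v 1 0).
split=> //; split=> // x; apply/matrixP => i j.
rewrite (ord1 j) /act [LHS]mxE mulmx2E !mxE.
by move: i; apply: ord2P.
Qed.

(* The minus sign of [superjac] cancels the sign [grade] puts on the odd B. *)
Lemma at_theta0_superjac Phi : Gs Phi -> at_theta0 (superjac Phi 0) = jac0 Phi.
Proof.
move=> G; apply/matrixP => i j; rewrite !mxE.
have /odd_grade gB := Gs_oddB G 0; have /even_grade gD := Gs_evenD G 0.
move: i j; apply: ord2P; apply: ord2P => //=.
by rewrite -/(coefB Phi 0) gB opprK.
Qed.

Lemma at_theta0_0 Phi : at_theta0 (Phi 0) = val0 Phi.
Proof.
by apply/matrixP => i j; rewrite (ord1 j) !mxE; move: i; apply: ord2P.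
Qed.

Lemma Gs2P phi : Gs2 phi <-> [/\ Gs phi, val0 phi = 0 & jac0 phi = 1%:M].
Proof.
rewrite /Gs2 at_theta0_0.
by split=> -[G v0 J]; split=> //; rewrite ?at_theta0_superjac //
  -at_theta0_superjac.
Qed.

(** * Existence and uniqueness of the factorization *)

Lemma Gs1_pi1 Phi : Gs Phi -> Gs1 (pi1 Phi).
Proof.
move=> G; apply/Gs1P; exists (jac0 Phi), (val0 Phi).
by split; [exact: super_gl2_jac0 | exact: super_vec_val0 |].
Qed.

(** With J and v the Jacobian and value of Phi at the origin and V the inverse of J, those of
    [pi2 Phi] are V J = 1 and V v - V v = 0. *)
Lemma Gs2_pi2 Phi : Gs Phi -> Gs2 (pi2 Phi).
Proof.
move=> G; have gJ := super_gl2_jac0 G; have [VJ _] := superinvK gJ.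
have gV := super_gl2_inv gJ; apply/Gs2P; rewrite pi2E; split.
- apply: Gs_act => //; apply: super_vecN; apply: super_vecM => //.
  exact: super_vec_val0.
- by rewrite val0_act subrr.
- by rewrite jac0_act.
Qed.

(** Here the other identity J V = 1 serves: the composite has linear part J V and translation v - J
    V v = 0. *)
Lemma supercomp_pi1_pi2 Phi : Gs Phi -> Phi = supercomp (pi1 Phi) (pi2 Phi).
Proof.
move=> G; have [_ JV] := superinvK (super_gl2_jac0 G).
rewrite pi1E supercomp_act pi2E act_comp JV.
by rewrite mulmxN mulmxA JV mul1mx addNr act1.
Qed.

Lemma Gs_supercomp psi phi : Gs1 psi -> Gs phi -> Gs (supercomp psi phi).
Proof.
move=> /Gs1P[M [v [gM gv ->]]] G; rewrite supercomp_act; exact: Gs_act.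
Qed.

Lemma factors_unique psi phi : Gs1 psi -> Gs2 phi ->
  pi1 (supercomp psi phi) = psi /\ pi2 (supercomp psi phi) = phi.
Proof.
move=> /Gs1P[M [v [gM gv ->]]] /Gs2P[G v0 J]; rewrite supercomp_act.
have eJ : jac0 (act M v phi) = M by rewrite jac0_act // J mulmx1.
have ev : val0 (act M v phi) = v by rewrite val0_act v0 mulmx0 add0r.
rewrite pi1E pi2E eJ ev act_comp; have [-> _] := superinvK gM.
by rewrite subrr act1.
Qed.

End AffineAction.
Unset Implicit Arguments.

Theorem mainTheorem1 (R : realType) (n : nat) :
  [set Phi : supermap R n | Gs Phi] =
    [set Phi : supermap R n | exists psi phi : supermap R n,
       [/\ Gs1 psi, Gs2 phi & Phi = supercomp psi phi]] /\
  forall Phi : supermap R n, Gs Phi ->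
    (exists! p : supermap R n * supermap R n,
       [/\ Gs1 p.1, Gs2 p.2 & Phi = supercomp p.1 p.2]) /\
    [/\ Gs1 (pi1 Phi), Gs2 (pi2 Phi) & Phi = supercomp (pi1 Phi) (pi2 Phi)].
Proof.
have fact Phi : Gs Phi ->
    [/\ Gs1 (pi1 Phi), Gs2 (pi2 Phi) & Phi = supercomp (pi1 Phi) (pi2 Phi)].
  by move=> G; split; [exact: Gs1_pi1|exact: Gs2_pi2|exact: supercomp_pi1_pi2].
split.
  apply/seteqP; split=> Phi /= => [/fact G | [psi [phi [G1 /Gs2P[G2 _ _] ->]]]].
    by exists (pi1 Phi), (pi2 Phi).
  exact: Gs_supercomp.
move=> Phi G; split; last exact: fact.
exists (pi1 Phi, pi2 Phi); split; first exact: fact.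
(* Replacing Phi by the competing product turns the chosen pair into the two projections of that
   product, which recover its factors. *)
move=> [psi phi] /= [G1 G2 ->].
by have [-> ->] := factors_unique G1 G2.
Qed.
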